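(* Let $n\in\mathbb{N}$, $(\kappa,k)\in\mathcal{L}_n$ and $\kappa\in C_{-1}^{n-1}(0,+\infty)$. Then for every function $f\in C_{-1,(k)}^{(1)}(0,+\infty)$, $$(\mathbb{I}_{(\kappa)}\,\mathbb{D}_{(k)}\,f)(t)=f(t)-\sum_{i=0}^{n-1}\left(\frac{d^i}{dt^i}\,\mathbb{I}_{(k)}f\right)(0)\ \frac{d^{\,n-1-i}\kappa}{dt^{\,n-1-i}}(t),\qquad t>0.$$
   Context: Functions are (real- or complex-valued) functions of $t>0$. $(f*g)(t)=\int_0^t f(t-\tau)g(\tau)\,d\tau$ is the Laplace convolution, and $h_n(t)=t^{n-1}/(n-1)!$ for $n\in\mathbb{N}=\{1,2,\dots\}$. $C_{-1}(0,+\infty)=\{f:\ f(t)=t^pf_1(t),\ t>0,\ p>-1,\ f_1\in C[0,+\infty)\}$. $C_{-1,0}(0,+\infty)=\{f:\ f(t)=t^pf_1(t),\ t>0,\ -1<p<0,\ f_1\in C[0,+\infty)\}$. For $m\in\mathbb{N}_0$, $C_{-1}^m(0,+\infty)=\{f\in C_{-1}(0,+\infty):\ f^{(m)}\in C_{-1}(0,+\infty)\}$ (derivative taken on $(0,+\infty)$). $\mathcal{L}_n$ is the set of pairs $(\kappa,k)$ with $\kappa\in C_{-1}(0,+\infty)$, $k\in C_{-1,0}(0,+\infty)$ and $(\kappa*k)(t)=h_n(t)$ for all $t>0$. General fractional integrals: $(\mathbb{I}_{(\kappa)}f)(t)=(\kappa*f)(t)$ and $(\mathbb{I}_{(k)}f)(t)=(k*f)(t)$,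 $t>0$. General fractional derivative of Riemann-Liouville type: $(\mathbb{D}_{(k)}f)(t)=\frac{d^n}{dt^n}(k*f)(t)$, $t>0$, with natural domain $C_{-1,(k)}^{(1)}(0,+\infty)=\{f\in C_{-1}(0,+\infty):\ \mathbb{D}_{(k)}f \text{ exists on } (0,+\infty) \text{ and } \mathbb{D}_{(k)}f\in C_{-1}(0,+\infty)\}$. Values at $0$ such as $\left(\frac{d^i}{dt^i}\mathbb{I}_{(k)}f\right)(0)$ are understood as limits for $t\to 0+$ (their existence is part of the assertion). *)

(* Defs.v *)
From HB Require Import structures.
From mathcomp Require Import all_boot all_order all_algebra.
From mathcomp Require Import complex.
From mathcomp Require Import all_classical all_reals all_analysis.
Set Implicit Arguments.
Unset Strict Implicit.
Unset Printing Implicit Defensive.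
Import Order.TTheory GRing.Theory Num.Theory.
Import numFieldNormedType.Exports.
Local Open Scope classical_set_scope.
Local Open Scope ring_scope.
Local Open Scope complex_scope.

(* A complex-valued function of t > 0 is represented by a total function
   f : R -> R[i]; its values at t <= 0 are irrelevant to the function classes,
   convolutions and derivatives (at t > 0) below. Real-valued functions are those
   with vanishing imaginary part. Continuity, limits, derivatives and integrals
   are taken on the real and imaginary parts. *)

Definition re_part (R : realType) (f : R -> R[i]) : R -> R :=
  fun t => complex.Re (f t).

Definition im_part (R : realType) (f : R -> R[i]) : R -> R :=
  fun t => complex.Im (f t).

Definition ccontinuous_within (R : realType) (A : set R) (f : R -> R[i]) : Prop :=
  {within A, continuous (re_part f)} /\ {within A, continuous (im_part f)}.

Definition right_limit_at0 (R : realType) (f : R -> R[i]) (l : R[i]) : Prop :=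
  re_part f t @[t --> 0^'+] --> complex.Re l /\
  im_part f t @[t --> 0^'+] --> complex.Im l.

Definition cderiven (R : realType) (n : nat) (f : R -> R[i]) : R -> R[i] :=
  fun t => derive1n n (re_part f) t +i* derive1n n (im_part f) t.

Definition cderivable_n (R : realType) (n : nat) (f : R -> R[i]) : Prop :=
  forall (i : nat) (t : R), (i < n)%N -> 0 < t ->
    derivable (derive1n i (re_part f)) t 1 /\
    derivable (derive1n i (im_part f)) t 1.

(* Lebesgue integral; absolutely convergent in every convolution of two
   functions of the class Cm1 below. *)
Definition cintegral (R : realType) (A : set R) (f : R -> R[i]) : R[i] :=
  Rintegral (@lebesgue_measure R) A (re_part f) +i*
  Rintegral (@lebesgue_measure R) A (im_part f).

Definition laplace_conv (R : realType) (f g : R -> R[i]) : R -> R[i] :=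
  fun t => cintegral `]0, t[ (fun tau => f (t - tau) * g tau).

Definition h_power (R : realType) (n : nat) : R -> R[i] :=
  fun t => (t ^+ n.-1 / (n.-1)`!%:R)%:C.

Definition Cm1 (R : realType) (f : R -> R[i]) : Prop :=
  exists (p : R) (f1 : R -> R[i]),
    [/\ -1 < p,
        ccontinuous_within `[0, +oo[ f1 &
        forall t : R, 0 < t -> f t = (t `^ p)%:C * f1 t].

Definition Cm10 (R : realType) (f : R -> R[i]) : Prop :=
  exists (p : R) (f1 : R -> R[i]),
    [/\ -1 < p, p < 0,
        ccontinuous_within `[0, +oo[ f1 &
        forall t : R, 0 < t -> f t = (t `^ p)%:C * f1 t].

Definition Cm1_n (R : realType) (m : nat) (f : R -> R[i]) : Prop :=
  [/\ Cm1 f, cderivable_n m f & Cm1 (cderiven m f)].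

Definition kernel_pair (R : realType) (n : nat) (kappa k : R -> R[i]) : Prop :=
  [/\ Cm1 kappa, Cm10 k &
      forall t : R, 0 < t -> laplace_conv kappa k t = h_power n t].

Definition GFI (R : realType) (kappa f : R -> R[i]) : R -> R[i] :=
  laplace_conv kappa f.

Definition GFD (R : realType) (n : nat) (k f : R -> R[i]) : R -> R[i] :=
  cderiven n (laplace_conv k f).

Definition GFD_domain (R : realType) (n : nat) (k f : R -> R[i]) : Prop :=
  [/\ Cm1 f, cderivable_n n (laplace_conv k f) & Cm1 (GFD n k f)].

(* Main.v *)
Require Import Defs.
From HB Require Import structures.
From mathcomp Require Import all_boot all_order all_algebra.
From mathcomp Require Import complex.
From mathcomp Require Import all_classical all_reals all_analysis.
From mathcomp Require Import measurable_realfun ring lra.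
Set Implicit Arguments.
Unset Strict Implicit.
Unset Printing Implicit Defensive.
Import Order.TTheory GRing.Theory Num.Theory.
Import numFieldNormedType.Exports.
Local Open Scope classical_set_scope.
Local Open Scope ring_scope.
Local Open Scope complex_scope.

(** The identity is obtained by differentiating a convolution identity [n]
times, which avoids any discussion of the behaviour of [kappa] at the origin.

Put [g = k * f] and [phi = g^(n)], the fractional derivative of [f]. Let [J] be
integration from [0], that is convolution with the constant [1]. As [phi] is
continuous for [t > 0] and integrable at [0], integrating it [n] times gives the
Taylor expansion [g = sum_(i < n) a_i J^i 1 + J^n phi], in which the constants of
integration [a_i] are the limits of [g^(i)] at [0+] (lemma [taylor_mild]).
Convolve with [kappa]. On the left, associativity and [kappa * k = h_n] give
[kappa * g = h_n * f = J^n f]. On the right, convolution commutes with [J] and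
[kappa * 1 = J kappa]. Hence
[J^n f = sum_(i < n) a_i J^(i+1) kappa + J^n (kappa * phi)]. The [n]-th derivative
of [J^(i+1) kappa] is [kappa^(n-1-i)] (lemma [has_deriven_convol]), so that [n]
differentiations turn this equality into the theorem.

The analytic work is to make this algebra legitimate. Everything takes place
in the class [mild] of functions that are continuous for [t > 0] and integrable
on [(0, T)] for every [T]; it contains the real and imaginary parts of the
functions [t^p f_1(t)] with [p > -1]. Lemmas [mild_convol], [convolC] and
[convolA] say that convolution is an internal, commutative and associative
operation on this class; continuity of [kappa * phi] is what makes the
final differentiation valid at every [t > 0] and not only almost everywhere. *)

(** * Reflections of the line *)

Section reflection.
Context {R : realType}.
Notation mu := (@lebesgue_measure R).

Definition reflection (t : R) : measurableTypeR R -> measurableTypeR R :=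
  fun x => t - x.

Lemma measurable_reflection t : measurable_fun setT (reflection t).
Proof. exact: measurable_funB. Qed.

HB.instance Definition _ t := isMeasurableFun.Build _ _ _ _
  (reflection t) (measurable_reflection t).

Lemma lebesgue_measure_reflection t (A : set R) : measurable A ->
  pushforward mu (reflection t) A = mu A.
Proof.
move=> mA; apply/esym/lebesgue_measure_unique => //= _ [[a b]] _ <-.
rewrite /pushforward.
have -> : reflection t @^-1` `]a, b] = `[t - b, t - a[%classic.
  apply/seteqP; split => x; rewrite /reflection /= !in_itv/=; lra.
rewrite !lebesgue_measure_itv/= !lte_fin.
have -> : (t - b < t - a) = (a < b) by rewrite ltrD2l ltrN2.
by case: ifP => // _; rewrite -!EFinB; congr EFin; lra.
Qed.

Lemma ge0_integral_reflection t (F : R -> \bar R) :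
  measurable_fun setT F -> (forall x, 0 <= F x)%E ->
  (\int[mu]_x F (t - x)%R = \int[mu]_x F x)%E.
Proof.
move=> mF F0.
transitivity (\int[pushforward mu (reflection t)]_x F x)%E.
  by rewrite ge0_integral_pushforward.
by apply: eq_measure_integral => A mA _; exact: lebesgue_measure_reflection.
Qed.

Lemma integrable_reflection t (f : R -> R) :
  mu.-integrable setT (EFin \o f) ->
  mu.-integrable setT (EFin \o (fun x => f (t - x))).
Proof.
move=> /integrableP[mf fi]; apply/integrableP; split.
  by apply: (measurableT_comp mf); exact: measurable_reflection.
rewrite (ge0_integral_reflection t (F := fun x => (`|f x|)%:E))//.
by apply/measurable_EFinP; apply: measurableT_comp => //; exact/measurable_EFinP.
Qed.

Lemma integral_reflection t (f : R -> R) :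
  mu.-integrable setT (EFin \o f) ->
  (\int[mu]_x (f (t - x))%:E = \int[mu]_x (f x)%:E)%E.
Proof.
move=> fi.
transitivity (\int[pushforward mu (reflection t)]_x (f x)%:E)%E.
  rewrite (@integral_pushforward _ _ _ _ _ _ (measurable_reflection t) mu setT)//.
  - exact: measurable_int fi.
  - exact: integrable_reflection.
by apply: eq_measure_integral => A mA _; exact: lebesgue_measure_reflection.
Qed.

Lemma Rintegral_reflection t (f : R -> R) :
  mu.-integrable setT (EFin \o f) ->
  \int[mu]_x f (t - x) = \int[mu]_x f x.
Proof. by move=> fi; rewrite /Rintegral integral_reflection. Qed.

End reflection.

(** * Continuous functions on the half-line, integrable at the origin *)

Section mild_functions.
Context {R : realType}.
Notation mu := (@lebesgue_measure R).
Implicit Types (f g h : R -> R) (t : R).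

(** The only two properties of the functions [t^p f_1(t)], [p > -1], that the argument
uses; unlike a prescribed singularity exponent, they are manifestly stable under sums. *)
Definition mild f :=
  (forall t, 0 < t -> {for t, continuous f}) /\
  (forall T, mu.-integrable `]0, T[ (EFin \o f)).

(** Extension by zero: with it a convolution becomes an integral over the whole line, and
reflections and Fubini's theorem apply without moving domains of integration. *)
Definition ext f : R -> R := fun x => if 0 < x then f x else 0.

Lemma ext_restrict f : ext f = f \_ `]0, +oo[.
Proof.
apply/funext => x; rewrite patchE /ext.
case: ifPn => x0; first by rewrite mem_set//= in_itv/= x0.
by rewrite memNset//= in_itv/= andbT; exact/negP.
Qed.

Lemma measurable_ext f : mild f -> measurable_fun setT (ext f).
Proof.
move=> [cf _]; rewrite ext_restrict; apply: (proj1 (measurable_restrictT f _)) => //.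
apply: open_continuous_measurable_fun; first by exact: interval_open.
by move=> x; rewrite inE/= in_itv/= andbT => /cf.
Qed.

Lemma integrable_cut f T : mild f ->
  mu.-integrable setT (EFin \o (f \_ `]0, T[)).
Proof.
move=> [_ /(_ T) If].
pose D : set (measurableTypeR R) := `]0, T[%classic.
have mD : measurable D by exact: measurable_itv.
have := @integrable_mkcond _ _ R mu D (EFin \o f) mD.
by rewrite restrict_EFin => -[h _]; apply: h.
Qed.

Lemma continuous_itv_bounded h a b : continuous h ->
  exists2 M, 0 <= M & forall x, a <= x <= b -> `|h x| <= M.
Proof.
move=> ch; have ch' : {within `[a, b], continuous h} by exact: continuous_subspaceT.
have [M [Mr hM]] := compact_bounded (continuous_compact ch' (@segment_compact _ a b)).
exists (`|M| + 1) => // x xab; apply: hM; first by rewrite ltr_pwDr// ler_norm.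
by exists x => //=; rewrite in_itv.
Qed.

Lemma integrable_continuousM h g T : continuous h ->
  mu.-integrable `]0, T[ (EFin \o g) ->
  mu.-integrable `]0, T[ (EFin \o (fun x => h x * g x)).
Proof.
move=> ch ig.
have mh : measurable_fun `]0, T[ h.
  by apply: measurable_funTS; exact: continuous_measurable_fun.
have [M M0 hM] := continuous_itv_bounded 0 T ch.
have bh : [bounded h x | x in `]0, T[].
  exists M; split; first exact: num_real.
  move=> r Mr x /=; rewrite in_itv/= => /andP[x0 xT].
  by rewrite (le_trans (hM x _)) ?ltW// (ltW x0) (ltW xT).
have := @integrableMr _ _ _ mu `]0, T[%classic _ h _ mh bh ig.
by move=> /(_ (measurable_itv _)).
Qed.

Lemma continuous_mild h : continuous h -> mild h.
Proof.
move=> ch; split => [t _|T]; first exact: ch.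
apply: (@integrableS _ _ _ mu `[0, T]%classic) => //.
  by apply: subset_itv; rewrite bnd_simp.
apply: continuous_compact_integrable; first exact: segment_compact.
exact: continuous_subspaceT.
Qed.

Lemma mild_cst (a : R) : mild (cst a).
Proof. by apply: continuous_mild => x; exact: cst_continuous. Qed.

Lemma mildD f g : mild f -> mild g -> mild (f \+ g).
Proof.
move=> [cf If] [cg Ig]; split => [t t0|T]; first exact: continuousD (cf _ t0) (cg _ t0).
by apply: eq_integrable (integrableD _ (If T) (Ig T)).
Qed.

Lemma mildZ (a : R) f : mild f -> mild (fun x => a * f x).
Proof.
move=> [cf If]; split => [t t0|T]; first by apply: continuousM; [exact: cst_continuous|exact: cf].
by apply: eq_integrable (integrableZl _ a (If T)).
Qed.

Lemma mildB f g : mild f -> mild g -> mild (f \- g).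
Proof.
move=> mf mg; have := mildD mf (mildZ (-1) mg).
by congr mild; apply/funext => x /=; rewrite mulN1r.
Qed.

Lemma mild_sum n (a : nat -> R) (F : nat -> R -> R) : (forall i, mild (F i)) ->
  mild (fun t => \sum_(i < n) a i * F i t).
Proof.
move=> mF; elim: n => [|n IH].
  by have := mild_cst 0; congr mild; apply/funext => t; rewrite big_ord0.
have := mildD IH (mildZ (a n) (mF n)).
by congr mild; apply/funext => t; rewrite big_ord_recr.
Qed.

Lemma mild_norm f : mild f -> mild (Num.norm \o f).
Proof.
move=> [cf If]; split => [t t0|T]; last exact: integrable_norm.
by apply: continuous_comp; [exact: cf|exact: norm_continuous].
Qed.

Definition freeze (c : R) f : R -> R := fun x => f (Num.max x c).

Lemma freeze_continuous c f : (forall t, c <= t -> {for t, continuous f}) ->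
  continuous (freeze c f).
Proof.
move=> cf x; apply: continuous_comp => /=.
  by apply: continuous_max; [exact: cvg_id|exact: cst_continuous].
by apply: cf; rewrite le_max lexx orbT.
Qed.

Lemma mild_freeze c f : 0 < c -> mild f -> continuous (freeze c f).
Proof.
by move=> c0 [cf _]; apply: freeze_continuous => t ct; exact/cf/(lt_le_trans c0).
Qed.

Lemma freezeE c f x : c <= x -> freeze c f x = f x.
Proof. by move=> cx; rewrite /freeze max_l. Qed.

End mild_functions.

(** * Laplace convolution as an integral over the line *)

Section convolution.
Context {R : realType}.
Notation mu := (@lebesgue_measure R).
Implicit Types (f g h : R -> R) (t : R).

Definition convol f g : R -> R :=
  fun t => \int[mu]_(x in `]0, t[) (f (t - x) * g x).

Lemma convol_integrandE f g t :
  (fun x => f (t - x) * g x) \_ `]0, t[ = (fun x => ext f (t - x) * ext g x).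
Proof.
apply/funext => x; rewrite patchE /ext subr_gt0.
case: ifPn; first by rewrite inE/= in_itv/= => /andP[-> ->].
rewrite notin_setE/= in_itv/= => /negP; rewrite negb_and.
by case/orP => /negbTE ->; rewrite ?mulr0 ?mul0r.
Qed.

Lemma convolE f g t : convol f g t = \int[mu]_x (ext f (t - x) * ext g x).
Proof. by rewrite /convol Rintegral_mkcond convol_integrandE. Qed.

Lemma integrable_extM f g t :
  mu.-integrable `]0, t[ (EFin \o (fun x => f (t - x) * g x)) <->
  mu.-integrable setT (EFin \o (fun x => ext f (t - x) * ext g x)).
Proof.
pose D : set (measurableTypeR R) := `]0, t[%classic.
have mD : measurable D by exact: measurable_itv.
have := @integrable_mkcond _ _ R mu D (EFin \o (fun x => f (t - x) * g x)) mD.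
by rewrite restrict_EFin convol_integrandE.
Qed.

Lemma extD f g t : ext (f \+ g) t = ext f t + ext g t.
Proof. by rewrite /ext; case: ifP => //; rewrite addr0. Qed.

Lemma extZ a f t : ext (fun x => a * f x) t = a * ext f t.
Proof. by rewrite /ext; case: ifP => //; rewrite mulr0. Qed.

Lemma ext_norm f t : ext (Num.norm \o f) t = `|ext f t|.
Proof. by rewrite /ext; case: ifP => //; rewrite normr0. Qed.

Lemma eq_ext f g : (forall t, 0 < t -> f t = g t) -> ext f = ext g.
Proof. by move=> fg; apply/funext => t; rewrite /ext; case: ifPn => // /fg. Qed.

Lemma eq_convol f f' g g' : (forall t, 0 < t -> f t = f' t) ->
  (forall t, 0 < t -> g t = g' t) -> convol f g = convol f' g'.
Proof. by move=> ff gg; apply/funext => t; rewrite !convolE (eq_ext ff) (eq_ext gg). Qed.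

Lemma convol_le0 f g t : t <= 0 -> convol f g t = 0.
Proof.
by move=> t0; rewrite /convol set_itv_ge ?Rintegral_set0// -leNgt bnd_simp.
Qed.

Lemma convol0l g : convol (fun=> 0) g = fun=> 0.
Proof.
apply/funext => t; rewrite /convol; under eq_Rintegral do rewrite mul0r.
by rewrite Rintegral_cst// mul0r.
Qed.

Lemma ext_convol f g : ext (convol f g) = convol f g.
Proof.
by apply/funext => t; rewrite /ext; case: ltP => // t0; rewrite convol_le0.
Qed.

Lemma integrable_ext_contM h g t : continuous h -> mild g ->
  mu.-integrable setT (EFin \o (fun x => ext h (t - x) * ext g x)).
Proof.
move=> ch [_ ig]; apply/integrable_extM.
apply: (integrable_continuousM (h := fun x => h (t - x))); last exact: ig.
move=> x; apply: continuous_comp; last exact: ch.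
by apply: continuousB; [exact: cst_continuous|exact: cvg_id].
Qed.

Lemma integrable_ext_swap f g t :
  mu.-integrable setT (EFin \o (fun x => ext f (t - x) * ext g x)) ->
  mu.-integrable setT (EFin \o (fun x => ext g (t - x) * ext f x)).
Proof.
move=> /(integrable_reflection t); congr (_.-integrable _ _).
by apply/funext => x /=; rewrite subKr mulrC.
Qed.

(** Both terms on the right have a continuous factor. The missing product, of
[f - freeze c f] at [t - x] by [g - freeze c g] at [x], vanishes because [x] and
[t - x] cannot both be smaller than [c] when [2 * c <= t]. *)
Lemma ext_split f g c t x : 2 * c <= t ->
  ext f (t - x) * ext g x = ext f (t - x) * ext (freeze c g) x +
    ext (freeze c f) (t - x) * ext (g \- freeze c g) x.
Proof.
move=> tc; rewrite /ext; case: ltP => t0; case: ltP => x0; rewrite ?mulr0 ?mul0r ?addr0//=.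
have [cx|xc] := leP c x; first by rewrite (freezeE g cx) subrr mulr0 addr0.
by rewrite (@freezeE _ c f (t - x)); [ring|lra].
Qed.

(** The singularities of the integrand, at [x = 0] and at [x = t], are separated by freezing
each factor below [t / 2]: each term of [ext_split] is a bounded function times an
integrable one, possibly after the reflection of [(0, t)]. *)
Lemma integrable_ext f g t : mild f -> mild g ->
  mu.-integrable setT (EFin \o (fun x => ext f (t - x) * ext g x)).
Proof.
move=> mf mg; have [t0|t0] := leP t 0.
  apply/integrable_extM; rewrite set_itv_ge; first exact: integrable_set0.
  by rewrite -leNgt bnd_simp.
have tt : 2 * (t / 2) <= t by lra.
have c0 : 0 < t / 2 by rewrite divr_gt0.
have cg := mild_freeze c0 mg.
have cf := mild_freeze c0 mf.
have mg' : mild (g \- freeze (t / 2) g) by apply: mildB => //; exact: continuous_mild.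
have I1 := integrable_ext_swap (integrable_ext_contM t cg mf).
have I2 := integrable_ext_contM t cf mg'.
apply: eq_integrable (integrableD _ I1 I2) => // x _.
by rewrite [RHS]/= (@ext_split f g _ _ x tt).
Qed.

Lemma convolC f g : mild f -> mild g -> convol f g = convol g f.
Proof.
move=> mf mg; apply/funext => t; rewrite !convolE.
rewrite -(Rintegral_reflection t (integrable_ext t mf mg)).
by apply: eq_Rintegral => x _; rewrite subKr mulrC.
Qed.

Lemma convolDr f g h : mild f -> mild g -> mild h ->
  convol f (g \+ h) = convol f g \+ convol f h.
Proof.
move=> mf mg mh; apply/funext => t /=; rewrite !convolE -RintegralD//.
- by apply: eq_Rintegral => x _; rewrite extD mulrDr.
- exact: integrable_ext.
- exact: integrable_ext.
Qed.

Lemma convolZr a f g : mild f -> mild g ->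
  convol f (fun x => a * g x) = (fun t => a * convol f g t).
Proof.
move=> mf mg; apply/funext => t /=; rewrite !convolE -RintegralZl//.
  by apply: eq_Rintegral => x _; rewrite extZ mulrCA.
exact: integrable_ext.
Qed.

Lemma convolBr f g h : mild f -> mild g -> mild h ->
  convol f (g \- h) = convol f g \- convol f h.
Proof.
move=> mf mg mh; have -> : g \- h = g \+ (fun x => -1 * h x).
  by apply/funext => x /=; rewrite mulN1r.
rewrite convolDr ?convolZr//; last exact: mildZ.
by apply/funext => x /=; rewrite mulN1r.
Qed.

Lemma convol_sumr n (a : nat -> R) (F : nat -> R -> R) f :
  mild f -> (forall i, mild (F i)) ->
  convol f (fun t => \sum_(i < n) a i * F i t) =
    (fun t => \sum_(i < n) a i * convol f (F i) t).
Proof.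
move=> mf mF; elim: n => [|n IH].
  apply/funext => t; rewrite big_ord0 convolE.
  under eq_Rintegral do rewrite /ext big_ord0 if_same mulr0.
  by rewrite Rintegral_cst// mul0r.
have -> : (fun t => \sum_(i < n.+1) a i * F i t) =
    (fun t => \sum_(i < n) a i * F i t) \+ (fun t => a n * F n t).
  by apply/funext => t; rewrite big_ord_recr.
rewrite convolDr ?IH ?convolZr//; [|exact: mild_sum|exact: mildZ].
by apply/funext => t; rewrite big_ord_recr.
Qed.

End convolution.

(** * Primitives and continuous kernels *)

Section primitive.
Context {R : realType}.
Notation mu := (@lebesgue_measure R).
Implicit Types (f g h : R -> R) (t : R).

Definition primitive f : R -> R := convol (fun=> 1) f.

Lemma primitiveE f t : primitive f t = \int[mu]_(x in `]0, t[) f x.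
Proof. by apply: eq_Rintegral => x _; rewrite mul1r. Qed.

(** Continuity at [t] gives the derivative at this very point, rather than almost everywhere. *)
Lemma is_derive_primitive f t : mild f -> 0 < t ->
  is_derive t 1 (primitive f) (f t).
Proof.
move=> [cf If] t0.
have If' u : mu.-integrable `]0, u] (EFin \o f).
  apply: (@integrableS _ _ _ mu `]0, u + 1[%classic) => //.
  by apply: subset_itvl; rewrite bnd_simp ltrDl.
have -> : primitive f = fun x => \int[mu]_(y in `]0, x]) f y.
  by apply/funext => x; rewrite primitiveE Rintegral_itv_bndo_bndc.
have [||d e] := @continuous_FTC1 R f (BRight 0) t (t + 1) _ (If' _) _ (cf _ t0).
- by rewrite ltrDl.
- by [].
- by apply: DeriveDef; [exact: d|rewrite -derive1E; exact: e].
Qed.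

Lemma primitive_cvg0 f : mild f -> primitive f t @[t --> 0^'+] --> 0.
Proof.
move=> mf.
pose g := f \_ `]0, 1[.
have ig : mu.-integrable `[0, 1] (EFin \o g).
  apply: (@integrableS _ _ _ mu setT) => //.
  exact: integrable_cut.
have /cvg_at_right_filter := @parameterized_integral_cvg_left R 0 1 g ltr01 ig.
apply: cvg_trans; apply: near_eq_cvg; near=> t.
have t0 : 0 < t by [].
have t1 : t < 1 by near: t; exact: nbhs_right_lt.
have sub1 : `]0, t[ `<=` `]0, 1[ by apply: subset_itvl; rewrite bnd_simp ltW.
rewrite primitiveE /parameterized_integral.
rewrite -Rintegral_itv_obnd_cbnd; last first.
  apply: (@integrableS _ _ _ mu `[0, 1]%classic) => //.
  by apply: subset_itv; rewrite bnd_simp// ltW.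
rewrite -Rintegral_itv_bndo_bndc; last first.
  apply: (@integrableS _ _ _ mu `[0, 1]%classic) => //.
  by apply: subset_itv; rewrite bnd_simp// ltW.
apply: eq_Rintegral => x; rewrite inE => xt.
by rewrite /g patchE mem_set//; exact: sub1.
Unshelve. all: by end_near. Qed.

(** Subtracting the constant [h 0] makes the extension by zero of the kernel continuous on the
line, so that dominated convergence applies on a fixed interval; the constant itself
contributes a multiple of a primitive. *)
Lemma convol_continuousl h g t : continuous h -> mild g -> 0 < t ->
  {for t, continuous (convol h g)}.
Proof.
move=> ch mg t0.
pose k u := freeze 0 h u - h 0.
have ck : continuous k.
  move=> u; apply: continuousB; last exact: cst_continuous.
  by apply: (@freeze_continuous _ 0 h) => s _; exact: ch.
have k0 u : u <= 0 -> k u = 0 by move=> u0; rewrite /k /freeze max_r// subrr.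
pose T := 2 * t.
pose A s := \int[mu]_(x in `]0, T[) (k (s - x) * g x).
have ig := mg.2 T.
have ckM s : continuous (fun x => k (s - x)).
  move=> x; apply: (@continuous_comp _ _ _ (fun x => s - x) k); last exact: ck.
  by apply: continuousB; [exact: cst_continuous|exact: cvg_id].
have iA s : mu.-integrable `]0, T[ (EFin \o (fun x => k (s - x) * g x)).
  exact: integrable_continuousM (ckM s) ig.
have cA : {for t, continuous A}.
  have [M M0 kM] := continuous_itv_bounded (- T) T ck.
  apply: (@continuity_under_integral R _ _ mu (fun s x => k (s - x) * g x)
    `]0, T[%classic _ 0 T _ _ (fun x => M * `|g x|)) => //.
  - apply: aeW => x _ s _; rewrite /prop_for; apply: (@continuousM _ _ (fun s => k (s - x)) (cst (g x))); last exact: cst_continuous.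
    apply: (@continuous_comp _ _ _ (fun s => s - x) k); last exact: ck.
    by apply: continuousB; [exact: cvg_id|exact: cst_continuous].
  - by apply: eq_integrable (integrableZl _ M (integrable_norm ig)).
  - move=> s /=; rewrite in_itv/= => /andP[s0 sT].
    apply: aeW => x /=; rewrite in_itv/= => /andP[x0 xT].
    by rewrite normrM ler_wpM2r// kM//; apply/andP; split; lra.
  - by rewrite inE/= in_itv/= /T; apply/andP; split; lra.
have dJ : {for t, continuous (primitive g)}.
  apply: differentiable_continuous; apply/derivable1_diffP.
  exact: (@ex_derive _ _ _ _ _ _ _ (is_derive_primitive mg t0)).
have c2 : {for t, continuous (fun s => A s + h 0 * primitive g s)}.
  apply: continuousD; first exact: cA.
  by apply: continuousM; [exact: cst_continuous|exact: dJ].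
have eqAB : \forall s \near t, convol h g s = A s + h 0 * primitive g s.
  near=> s.
  have s0 : 0 < s by near: s; exact: lt_nbhsr.
  have sT : s < T by near: s; apply: lt_nbhsl; rewrite /T; lra.
  have -> : A s = \int[mu]_(x in `]0, s[) (k (s - x) * g x).
    rewrite /A Rintegral_mkcond [RHS]Rintegral_mkcond.
    apply: eq_Rintegral => x _; rewrite !patchE.
    case: ifPn => [|xT]; case: ifPn => //.
      rewrite notin_setE inE/= !in_itv/= => /negP + /andP[x0 xT].
      by rewrite x0/= -leNgt => sx; rewrite k0 ?mul0r// subr_le0.
    rewrite inE/= in_itv/= => /andP[x0 xs].
    by move: xT; rewrite notin_setE/= in_itv/= x0 (lt_trans xs sT).
  rewrite primitiveE -RintegralZl//; last exact: mg.2.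
  rewrite -RintegralD//.
  - apply: eq_Rintegral => x; rewrite inE/= in_itv/= => /andP[x0 xs].
    by rewrite /k freezeE ?subr_ge0 ?ltW//; ring.
  - exact: integrable_continuousM (ckM s) (mg.2 s).
  - by apply: eq_integrable (integrableZl _ (h 0) (mg.2 s)).
move: c2; rewrite /prop_for /continuous_at -(nbhs_singleton eqAB).
apply: cvg_trans; apply: near_eq_cvg.
by apply: filterS eqAB.
Unshelve. all: by end_near. Qed.

End primitive.

(** * The commutative algebra of convolution *)

Section convolution_algebra.
Context {R : realType}.
Notation mu := (@lebesgue_measure R).
Implicit Types (f g h : R -> R) (t : R).

(** For [s] close to [t], freezing below [t / 4] writes the convolution as a sum of two
convolutions with continuous kernels. *)
Lemma convol_continuous f g t : mild f -> mild g -> 0 < t ->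
  {for t, continuous (convol f g)}.
Proof.
move=> mf mg t0; pose c := t / 4.
have c0 : 0 < c by rewrite divr_gt0.
have cg := mild_freeze c0 mg.
have cf := mild_freeze c0 mf.
have mgc := continuous_mild cg.
have mg' : mild (g \- freeze c g) by exact: mildB.
have eqAB : \forall s \near t, convol f g s =
    convol (freeze c g) f s + convol (freeze c f) (g \- freeze c g) s.
  near=> s.
  have cs : 2 * c <= s.
    by apply: ltW; near: s; apply: lt_nbhsr; rewrite /c; lra.
  rewrite (convolC mgc mf) !convolE -RintegralD//.
  - by apply: eq_Rintegral => x _; exact: ext_split.
  - exact: integrable_ext.
  - by apply: integrable_ext => //; exact: continuous_mild.
have : {for t, continuous (convol (freeze c g) f \+
    convol (freeze c f) (g \- freeze c g))}.
  by apply: continuousD; exact: convol_continuousl.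
rewrite /prop_for /continuous_at /= -(nbhs_singleton eqAB).
apply: cvg_trans; apply: near_eq_cvg.
by apply: filterS eqAB.
Unshelve. all: by end_near. Qed.

Lemma EFin_convol f g t : mild f -> mild g ->
  ((convol f g t)%:E = \int[mu]_x (ext f (t - x) * ext g x)%:E)%E.
Proof.
move=> mf mg; rewrite convolE /Rintegral fineK//.
by apply: integrable_fin_num => //; exact: integrable_ext.
Qed.

Lemma cut_extM f g T t x : t < T ->
  (f \_ `]0, T[) (t - x) * (g \_ `]0, T[) x = ext f (t - x) * ext g x.
Proof.
move=> tT; rewrite !patchE /ext !mem_setE !in_itv/=.
by case: (ltP 0 (t - x)) => h1; case: (ltP 0 x) => h2; rewrite /= ?mulr0 ?mul0r//;
  rewrite ?ifT//; lra.
Qed.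

(** Tonelli: the [L1] norm on [(0, T)] of a convolution is at most the product
of the norms of the factors. *)
Lemma convol_integrable f g T : mild f -> mild g ->
  mu.-integrable `]0, T[ (EFin \o convol f g).
Proof.
move=> mf mg.
pose f' := f \_ `]0, T[; pose g' := g \_ `]0, T[.
have If : mu.-integrable setT (EFin \o f') := integrable_cut T mf.
have Ig : mu.-integrable setT (EFin \o g') := integrable_cut T mg.
have mf' : measurable_fun setT f' by apply/measurable_EFinP; exact: measurable_int If.
have mg' : measurable_fun setT g' by apply/measurable_EFinP; exact: measurable_int Ig.
pose F (z : measurableTypeR R * measurableTypeR R) := (f' (z.1 - z.2) * g' z.2)%:E.
have mF : measurable_fun setT F.
  apply/measurable_EFinP; apply: measurable_funM; apply: measurableT_comp => //.
  exact: measurable_funB.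
(* Translation invariance, a translation being a product of two reflections. *)
have nf y : (\int[mu]_x `|f' (x - y)|%:E = \int[mu]_x `|f' x|%:E)%E.
  have m1 : measurable_fun setT (fun x => `|f' x|%:E).
    by apply/measurable_EFinP; exact: measurableT_comp.
  rewrite -(@ge0_integral_reflection _ (- y) (fun x => `|f' x|%:E))//.
  rewrite -(@ge0_integral_reflection _ 0 (fun x => `|f' (- y - x)|%:E))//.
    by apply: eq_integral => x _; congr (`|f' _|%:E); lra.
  by apply: (measurableT_comp m1); exact: measurable_reflection.
have IF : (mu \x mu)%E.-integrable setT F.
  apply/integrable21ltyP => //.
  have -> : (\int[mu]_y \int[mu]_x `|F (x, y)| =
             \int[mu]_y ((\int[mu]_x `|f' x|%:E) * `|g' y|%:E))%E.
    apply: eq_integral => y _; rewrite -(nf y) muleC -ge0_integralZl//.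
    - by apply: eq_integral => x _; rewrite /F/= normrM EFinM muleC.
    - apply/measurable_EFinP; apply: measurableT_comp => //.
      by apply: (measurableT_comp mf'); exact: measurable_funB.
  rewrite ge0_integralZl//; last 2 first.
  - by apply/measurable_EFinP; exact: measurableT_comp.
  - by apply: integral_ge0.
  by apply: lte_mul_pinfty; [exact: integral_ge0|
    exact: integrable_fin_num (integrable_norm If)|case/integrableP: Ig].
pose D : set (measurableTypeR R) := `]0, T[%classic.
have mD : measurable D by exact: measurable_itv.
have := integrableS measurableT mD (@subsetT _ _) (integrable_fubini_F IF).
apply: eq_integrable => // x /set_mem; rewrite /D/= in_itv/= => /andP[x0 xT].
rewrite EFin_convol//; apply: eq_integral => y _.
by rewrite /F /= cut_extM.
Qed.

Lemma mild_convol f g : mild f -> mild g -> mild (convol f g).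
Proof.
by move=> mf mg; split => [t t0|T]; [exact: convol_continuous|exact: convol_integrable].
Qed.

(** Fubini's theorem for [f (t - x) g (x - y) h y]. Its absolute integrability at every [t], and
not only at almost every [t], holds because [|g| * |h|] is again [mild]. *)
Lemma convolA f g h : mild f -> mild g -> mild h ->
  convol f (convol g h) = convol (convol f g) h.
Proof.
move=> mf mg mh; apply/funext => t.
have mfg := mild_convol mf mg.
have mgh := mild_convol mg mh.
pose F (z : measurableTypeR R * measurableTypeR R) :=
  (ext f (t - z.1) * (ext g (z.1 - z.2) * ext h z.2))%:E.
have mF : measurable_fun setT F.
  have ? := measurable_ext mf.
  have ? := measurable_ext mg.
  have ? := measurable_ext mh.
  apply/measurable_EFinP; apply: measurable_funM; last apply: measurable_funM;
    apply: measurableT_comp => //; exact: measurable_funB.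
have IF : (mu \x mu)%E.-integrable setT F.
  apply/integrable12ltyP => //.
  have [[nf ng] nh] := (mild_norm mf, mild_norm mg, mild_norm mh).
  have -> : (\int[mu]_x \int[mu]_y `|F (x, y)| =
     \int[mu]_x (ext (Num.norm \o f) (t - x) *
       ext (convol (Num.norm \o g) (Num.norm \o h)) x)%:E)%E.
    apply: eq_integral => x _; rewrite ext_convol EFinM EFin_convol//.
    rewrite -integralZl//; last exact: integrable_ext.
    by apply: eq_integral => y _; rewrite /F/= !normrM !ext_norm.
  rewrite -EFin_convol ?ltry//; exact: mild_convol.
have E1 : (\int[mu]_x \int[mu]_y F (x, y) = (convol f (convol g h) t)%:E)%E.
  rewrite EFin_convol//; apply: eq_integral => x _.
  rewrite ext_convol EFinM EFin_convol// -integralZl//.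
  exact: integrable_ext.
have E2 : (\int[mu]_y \int[mu]_x F (x, y) = (convol (convol f g) h t)%:E)%E.
  rewrite EFin_convol//; apply: eq_integral => y _.
  rewrite ext_convol (convolC mf mg) EFinM EFin_convol// muleC -integralZl//; last first.
    exact: integrable_ext.
  rewrite -(integral_reflection t (f := fun x => ext h y * (ext g (t - y - x) * ext f x))).
    apply: eq_integral => x _; rewrite /F/=; congr EFin.
    rewrite (_ : t - y - (t - x) = x - y); first by ring.
    by rewrite opprB addrC subrKA.
  exact: (integrableZl _ (ext h y) (integrable_ext (t - y) mg mf)).
by have := Fubini IF; rewrite E1 E2 => -[].
Qed.

Lemma convolDl f g h : mild f -> mild g -> mild h ->
  convol (f \+ g) h = convol f h \+ convol g h.
Proof.
move=> mf mg mh; rewrite convolC//; last exact: mildD.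
by rewrite convolDr// (convolC mh mf) (convolC mh mg).
Qed.

Lemma convolBl f g h : mild f -> mild g -> mild h ->
  convol (f \- g) h = convol f h \- convol g h.
Proof.
move=> mf mg mh; rewrite convolC//; last exact: mildB.
by rewrite convolBr// (convolC mh mf) (convolC mh mg).
Qed.

End convolution_algebra.

(** * Iterated derivatives and Taylor expansion at the origin *)

Section iterated_derivatives.
Context {R : realType}.
Implicit Types (f g h : R -> R) (t : R).

(** A chain of pointwise derivatives on [t > 0]: as a relation, it adds up along sums and
concatenates without proofs of derivability being carried around. *)
Fixpoint has_deriven (n : nat) f g : Prop :=
  if n is m.+1 then
    exists2 h, (forall t, 0 < t -> is_derive t 1 f (h t)) & has_deriven m h g
  else forall t, 0 < t -> f t = g t.

Lemma eq_pos_is_derive f g t d : (forall s, 0 < s -> f s = g s) -> 0 < t ->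
  is_derive t 1 f d -> is_derive t 1 g d.
Proof.
move=> fg t0; apply: near_eq_is_derive; near=> s; apply: fg.
by near: s; exact: lt_nbhsr.
Unshelve. all: by end_near. Qed.

Lemma eq_has_deriven n f f' g g' : (forall t, 0 < t -> f t = f' t) ->
  (forall t, 0 < t -> g t = g' t) -> has_deriven n f g -> has_deriven n f' g'.
Proof.
elim: n f f' => [|n IH] f f' ff gg /=.
  by move=> fg t t0; rewrite -ff// -gg//; exact: fg.
move=> [h fh hg]; exists h; last exact: IH hg.
by move=> t t0; apply: eq_pos_is_derive ff t0 (fh t t0).
Qed.

Lemma has_deriven_unique n f g g' : has_deriven n f g -> has_deriven n f g' ->
  forall t, 0 < t -> g t = g' t.
Proof.
elim: n f => [|n IH] f /=; first by move=> fg fg' t t0; rewrite -fg// fg'.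
move=> [h fh hg] [h' fh' hg']; apply: (IH h) => //.
apply: eq_has_deriven hg' => // t t0.
by rewrite -(@derive_val _ _ _ _ _ _ _ (fh t t0)) -(@derive_val _ _ _ _ _ _ _ (fh' t t0)).
Qed.

Lemma has_deriven_cat m n f g h : has_deriven m f g -> has_deriven n g h ->
  has_deriven (m + n) f h.
Proof.
elim: m f => [|m IH] f /=; last by move=> [k fk kg] gh; exists k => //; exact: IH gh.
by move=> fg; apply: eq_has_deriven => // t t0; rewrite fg.
Qed.

Lemma has_derivenD n f f' g g' : has_deriven n f f' -> has_deriven n g g' ->
  has_deriven n (f \+ g) (f' \+ g').
Proof.
elim: n f g => [|n IH] f g /=; first by move=> ff gg t t0; rewrite ff// gg.
move=> [h fh hf] [k gk kg]; exists (h \+ k); last exact: IH.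
by move=> t t0; apply: is_deriveD; [exact: fh|exact: gk].
Qed.

Lemma has_derivenZ n a f f' : has_deriven n f f' ->
  has_deriven n (fun t => a * f t) (fun t => a * f' t).
Proof.
elim: n f => [|n IH] f /=; first by move=> ff t t0; rewrite ff.
move=> [h fh hf]; exists (fun t => a * h t); last exact: IH.
by move=> t t0; apply: is_deriveZ; exact: fh.
Qed.

Lemma has_derivenB n f f' g g' : has_deriven n f f' -> has_deriven n g g' ->
  has_deriven n (f \- g) (f' \- g').
Proof.
move=> ff gg; have := has_derivenD ff (has_derivenZ (-1) gg).
by apply: eq_has_deriven => t _ /=; rewrite mulN1r.
Qed.

Lemma has_deriven0 n : has_deriven n (fun=> 0) (fun=> 0).
Proof.
elim: n => [//|n IH] /=; exists (fun=> 0) => // t t0.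
exact: is_derive_cst.
Qed.

Lemma has_deriven_sum n m (a : nat -> R) (F G : nat -> R -> R) :
  (forall i, (i < m)%N -> has_deriven n (F i) (G i)) ->
  has_deriven n (fun t => \sum_(i < m) a i * F i t)
                (fun t => \sum_(i < m) a i * G i t).
Proof.
elim: m => [|m IH] FG.
  by apply: eq_has_deriven (has_deriven0 n) => t _; rewrite big_ord0.
have IH' := IH (fun i im => FG i (ltnW im)).
have := has_derivenD IH' (has_derivenZ (a m) (FG m (ltnSn m))).
by apply: eq_has_deriven => t _; rewrite big_ord_recr.
Qed.

Lemma has_deriven_derive1n n f :
  (forall i t, (i < n)%N -> 0 < t -> derivable (derive1n i f) t 1) ->
  has_deriven n f (derive1n n f).
Proof.
elim: n f => [//|n IH] f df; rewrite derive1Sn; exists (derive1 f).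
  by move=> t t0; apply: DeriveDef; [exact: (df 0)|rewrite derive1E].
apply: IH => i t im t0.
by rewrite -derive1Sn; apply: df.
Qed.

Lemma derive0_pos_cst f : (forall t, 0 < t -> is_derive t 1 f 0) ->
  forall s t, 0 < s -> 0 < t -> f s = f t.
Proof.
move=> df; suff lt_cst s t : 0 < s -> s < t -> f s = f t.
  move=> s t s0 t0; have [st|ts|->//] := ltgtP s t; first exact: lt_cst.
  by apply/esym; exact: lt_cst.
move=> s0 st; apply/esym/eqP; rewrite -subr_eq0.
have [||c _ ->] := @MVT R f (fun=> 0) s t st; last by rewrite mul0r.
- by move=> x; rewrite in_itv/= => /andP[sx _]; apply: df; exact: lt_trans sx.
- apply: derivable_within_continuous => x; rewrite in_itv/= => /andP[sx _].
  by apply: (@ex_derive _ _ _ _ _ _ 0); apply: df; exact: lt_le_trans sx.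
Qed.

Lemma mild_primitive f : mild f -> mild (primitive f).
Proof. by move=> mf; apply: mild_convol => //; exact: mild_cst. Qed.

Lemma mild_iter_primitive n f : mild f -> mild (iter n primitive f).
Proof. by move=> mf; elim: n => //= n; exact: mild_primitive. Qed.

Lemma has_deriven_iter_primitive n f : mild f ->
  has_deriven n (iter n primitive f) f.
Proof.
move=> mf; elim: n => [//|n IH] /=; exists (iter n primitive f) => // t t0.
by apply: is_derive_primitive => //; exact: mild_iter_primitive.
Qed.

(** A derivative integrable at [0] forces the function to have a limit there. *)
Lemma antiderivative_mild f F : mild F ->
  (forall t, 0 < t -> is_derive t 1 f (F t)) ->
  exists2 l, f t @[t --> 0^'+] --> l & forall t, 0 < t -> f t = l + primitive F t.
Proof.
move=> mF dF; pose c := f 1 - primitive F 1.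
have fE t : 0 < t -> f t = c + primitive F t.
  move=> t0; apply/eqP; rewrite -subr_eq; apply/eqP.
  apply: (@derive0_pos_cst (f \- primitive F)) => // s s0.
  by rewrite -(subrr (F s)); apply: is_deriveB; [exact: dF|exact: is_derive_primitive].
exists c => //.
have : c + primitive F t @[t --> 0^'+] --> c + 0.
  by apply: cvgD; [exact: cvg_cst|exact: primitive_cvg0].
rewrite addr0; apply: cvg_trans; apply: near_eq_cvg.
by near=> t; rewrite fE.
Unshelve. all: by end_near. Qed.

Lemma primitiveD f g : mild f -> mild g ->
  primitive (f \+ g) = primitive f \+ primitive g.
Proof. by move=> mf mg; apply: convolDr => //; exact: mild_cst. Qed.

Lemma primitive_sum n (a : nat -> R) (F : nat -> R -> R) :
  (forall i, mild (F i)) ->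
  primitive (fun t => \sum_(i < n) a i * F i t) =
    (fun t => \sum_(i < n) a i * primitive (F i) t).
Proof. by move=> mF; apply: convol_sumr => //; exact: mild_cst. Qed.

(** Induction on [n], applied to the derivative of [f]: its expansion is [mild], so
[antiderivative_mild] integrates it term by term and the limit of [f] enters as a new
constant term, shifting the other coefficients. The monomial [t^i / i!] is written as
the [i]-fold primitive of [1], the form in which it commutes with convolutions. *)
Lemma taylor_mild n f :
  (forall i t, (i < n)%N -> 0 < t -> derivable (derive1n i f) t 1) ->
  mild (derive1n n f) ->
  exists2 a : nat -> R,
    (forall i, (i < n)%N -> derive1n i f t @[t --> 0^'+] --> a i) &
    forall t, 0 < t -> f t = \sum_(i < n) a i * iter i primitive (fun=> 1) t
                             + iter n primitive (derive1n n f) t.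
Proof.
elim: n f => [f _ _|n IH f df mf].
  by exists (fun=> 0) => // t t0; rewrite big_ord0 add0r.
have [] := IH (derive1 f).
- by move=> i t im t0; rewrite -derive1Sn; exact: df.
- by rewrite -derive1Sn.
move=> a lima; rewrite -derive1Sn => fE.
pose G := (fun t => \sum_(i < n) a i * iter i primitive (fun=> 1) t)
  \+ iter n primitive (derive1n n.+1 f).
have mP i : mild (iter i primitive (fun=> 1 : R)).
  by apply: mild_iter_primitive; exact: mild_cst.
have mS := mild_sum n a mP.
have mI := mild_iter_primitive n mf.
have mG : mild G := mildD mS mI.
have [] := @antiderivative_mild f G mG.
  move=> t t0; rewrite -[G t]fE//; apply: DeriveDef; first exact: (df 0).
  by rewrite derive1E.
move=> l liml fG; exists (fun i => if i is j.+1 then a j else l).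
  by move=> [_//|i im]; rewrite derive1Sn; exact: lima.
move=> t t0; rewrite fG// primitiveD// primitive_sum//=.
by rewrite big_ord_recl mulr1 addrA.
Qed.

Lemma monomial_iter_primitive n t : 0 < t ->
  t ^+ n / n`!%:R = iter n primitive (fun=> 1) t.
Proof.
elim: n t => [t _|n IH t t0]; first by rewrite expr0 fact0 divr1.
have mP : mild (iter n primitive (fun=> 1 : R)).
  by apply: mild_iter_primitive; exact: mild_cst.
have dX (s : R) : 0 < s ->
    is_derive s 1 (fun x => x ^+ n.+1 / n.+1`!%:R) (iter n primitive (fun=> 1) s).
  move=> s0; rewrite -IH//.
  have -> : (fun x : R => x ^+ n.+1 / n.+1`!%:R) = n.+1`!%:R^-1 \*: (id ^+ n.+1).
    by apply/funext => x /=; rewrite exprfctE/= mulrC.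
  apply: (is_derive_eq (is_deriveZ _ (is_deriveX n.+1 (is_derive_id s 1)))).
  rewrite /= factS natrM invfM /GRing.scale/= mulr1.
  by rewrite mulrACA mulVf ?mul1r 1?mulrC// pnatr_eq0.
have [l liml ->//] := antiderivative_mild mP dX.
suff -> : l = 0 by rewrite add0r.
apply: (cvg_unique _ liml) => //.
suff c0 : {for 0, continuous (fun x : R => x ^+ n.+1 / n.+1`!%:R)}.
  have := cvg_at_right_filter c0.
  by rewrite /= exprS !mul0r.
by apply: continuousM; [exact: exprn_continuous|exact: cst_continuous].
Qed.

(** A primitive is a convolution by [1], so this is associativity and commutativity. *)
Lemma convol_iter_primitive n f g : mild f -> mild g ->
  convol f (iter n primitive g) = iter n primitive (convol f g).
Proof.
move=> mf mg; elim: n => //= n <-.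
have mg' := mild_iter_primitive n mg.
have m1 : mild (fun=> 1 : R) by exact: mild_cst.
by rewrite /primitive convolA// (convolC mf m1) -convolA.
Qed.

Lemma convol1 f : mild f -> convol f (fun=> 1) = primitive f.
Proof. by move=> mf; rewrite convolC//; exact: mild_cst. Qed.

Lemma convol_monomial n f : mild f ->
  convol (fun t => t ^+ n / n`!%:R) f = iter n.+1 primitive f.
Proof.
move=> mf; have m1 : mild (fun=> 1 : R) by exact: mild_cst.
rewrite (eq_convol (@monomial_iter_primitive n) (fun t _ => erefl (f t))).
rewrite convolC//; last exact: mild_iter_primitive.
by rewrite convol_iter_primitive// convol1// -iterSr.
Qed.

(** Convolving the Taylor expansion of [g] with [kappa] turns its term of index [i] into the
[i+1]-fold primitive of [kappa]; of the [n] differentiations, [i+1] undo the primitives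
and [n-1-i] reach [kappa] itself. *)
Lemma has_deriven_convol n (a : nat -> R) (K : nat -> R -> R) kappa g phi :
  mild kappa -> mild phi ->
  (forall i, (i < n)%N -> has_deriven i kappa (K i)) ->
  (forall t, 0 < t -> g t = \sum_(i < n) a i * iter i primitive (fun=> 1) t
                            + iter n primitive phi t) ->
  has_deriven n (convol kappa g)
    (fun t => \sum_(i < n) a i * K (n.-1 - i)%N t + convol kappa phi t).
Proof.
move=> mk mphi Kk gE.
have m1 : mild (fun=> 1 : R) by exact: mild_cst.
have mP i : mild (iter i primitive (fun=> 1 : R)) by exact: mild_iter_primitive.
have -> : convol kappa g =
    (fun t => \sum_(i < n) a i * iter i.+1 primitive kappa t) \+
    iter n primitive (convol kappa phi).
  rewrite (eq_convol (fun t _ => erefl (kappa t)) gE).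
  rewrite convolDr//; [|exact: (mild_sum n a mP)|exact: mild_iter_primitive].
  rewrite convol_sumr// convol_iter_primitive//; apply/funext => t /=.
  congr (_ + _); apply: eq_bigr => i _.
  by rewrite convol_iter_primitive// convol1// -iterSr.
apply: has_derivenD; last by apply: has_deriven_iter_primitive; exact: mild_convol.
apply: (@has_deriven_sum n n a (fun i => iter i.+1 primitive kappa)
  (fun i => K (n.-1 - i)%N)) => i im.
rewrite -[X in has_deriven X](_ : i.+1 + (n.-1 - i) = n)%N; last first.
  by case: n im {Kk gE} => // n im; rewrite addSn subnKC.
apply: (@has_deriven_cat _ _ _ kappa); first exact: has_deriven_iter_primitive.
by apply: Kk; case: n im {gE} => // n im; rewrite ltnS leq_subr.
Qed.

End iterated_derivatives.

(** * Power weights *)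

Section class_Cm1.
Context {R : realType}.
Notation mu := (@lebesgue_measure R).
Implicit Types (f g u : R -> R) (t p : R).

Lemma eq_mild f g : (forall t, 0 < t -> f t = g t) -> mild f -> mild g.
Proof.
move=> fg [cf If]; split => [t t0|T].
  rewrite /prop_for /continuous_at -fg//; apply: cvg_trans (cf _ t0).
  apply: near_eq_cvg; near=> s; apply: fg.
  by near: s; exact: lt_nbhsr.
apply: eq_integrable (If T) => // x.
by rewrite inE/= in_itv/= => /andP[x0 _]; rewrite fg.
Unshelve. all: by end_near. Qed.

Lemma continuousM_mild u f : continuous u -> mild f -> mild (fun t => u t * f t).
Proof.
move=> cu [cf If]; split => [t t0|T]; last exact: integrable_continuousM.
by apply: continuousM; [exact: cu|exact: cf].
Qed.

(** One-sided continuity at [0] is turned into continuity on the line, where products and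
bounds on compact intervals are available directly. *)
Lemma freeze0_continuous u : {within `[0, +oo[, continuous u} ->
  continuous (freeze 0 u).
Proof.
move=> /subspace_continuousP cu x.
have m0 : Num.max x 0 \in `[0, +oo[ by rewrite in_itv/= le_max lexx orbT.
apply: (@cvg_comp _ _ _ (fun y => Num.max y 0) u _ (within `[0, +oo[ (nbhs (Num.max x 0))));
  last exact: cu m0.
have cm : Num.max y 0 @[y --> x] --> Num.max x 0.
  by apply: continuous_max; [exact: cvg_id|exact: cst_continuous].
move=> P wP.
have Q : \forall y \near x, `[0, +oo[%classic (Num.max y 0) -> P (Num.max y 0).
  exact: cm _ wP.
apply: filterS Q => y; apply.
by rewrite /= in_itv/= le_max lexx orbT.
Qed.

(** The antiderivative [x^(p+1)/(p+1)] is bounded near [0], so the integrals over [[1/(i+1), T)]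
are bounded uniformly in [i] and monotone convergence concludes. *)
Lemma integrable_powR p T : -1 < p ->
  mu.-integrable `]0, T[ (EFin \o (@powR R ^~ p)).
Proof.
move=> p1; have q0 : 0 < p + 1 by lra.
have q1 : p + 1 != 0 by rewrite gt_eqF.
pose G x := (p + 1)^-1 * x `^ (p + 1).
have dG (x : R) : 0 < x -> is_derive x 1 G (x `^ p).
  move=> x0; apply: (is_derive_eq (is_deriveZ _ (is_derive1_powR (p + 1) x0))).
  by rewrite addrK /GRing.scale/= mulKf.
have cpow (x : R) : 0 < x -> {for x, continuous (@powR R ^~ p)}.
  move=> x0; apply: differentiable_continuous; apply/derivable1_diffP.
  by apply: ex_derive; exact: is_derive1_powR.
pose F (i : nat) : set (measurableTypeR R) := `[i.+1%:R^-1, T[%classic.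
have FT : \bigcup_i F i = `]0, T[%classic.
  apply/seteqP; split => x /=.
    move=> [i _]; rewrite /F/= !in_itv/= => /andP[ix ->]; rewrite andbT.
    by apply: lt_le_trans ix; rewrite invr_gt0.
  rewrite in_itv/= => /andP[x0 xT]; exists (Num.truncn x^-1) => //.
  rewrite /F/= in_itv/= xT andbT invf_ple ?posrE//.
  by apply/ltW; exact: truncnS_gt.
have mpow : measurable_fun setT (fun x => (x `^ p)%:E).
  by apply/measurable_EFinP; exact: measurable_powR.
apply/integrableP; split; first exact: measurable_funTS mpow.
under eq_integral do rewrite gee0_abs ?lee_fin ?powR_ge0//.
rewrite -FT.
have cv : (\int[mu]_(x in F i) (x `^ p)%:E @[i --> \oo] -->
    \int[mu]_(x in \bigcup_i F i) (x `^ p)%:E)%E.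
  apply: ge0_nondecreasing_set_cvg_integral => //.
  - move=> i j ij; apply/subsetPset; rewrite /F; apply: subset_itvr.
    by rewrite bnd_simp lef_pV2 ?posrE// ler_nat.
  - by move=> i; exact: measurable_itv.
  - by move=> i; exact: measurable_funTS mpow.
  - by move=> i x _; rewrite lee_fin powR_ge0.
rewrite -(cvg_lim _ cv)//.
apply: (@le_lt_trans _ _ (G T)%:E); last exact: ltry.
apply: lime_le; first by apply/cvg_ex; eexists; exact: cv.
apply: nearW => i.
have [Ti|iT] := leP T i.+1%:R^-1.
  rewrite /F set_itv_ge ?integral_set0 ?bnd_simp -?leNgt//.
  by rewrite lee_fin mulr_ge0 ?powR_ge0// invr_ge0 ltW.
have i0 : 0 < i.+1%:R^-1 :> R by rewrite invr_gt0.
rewrite /F integral_itv_bndo_bndc; last exact: measurable_funTS mpow.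
rewrite (@continuous_FTC2 _ _ G)//.
- by rewrite -EFinB lee_fin gerBl mulr_ge0 ?powR_ge0// invr_ge0 ltW.
- apply: continuous_in_subspaceT => x.
  by rewrite inE/= in_itv/= => /andP[ix _]; apply: cpow; exact: lt_le_trans ix.
- have cG (x : R) : 0 < x -> {for x, continuous G}.
    move=> x0; apply: differentiable_continuous; apply/derivable1_diffP.
    by apply: ex_derive; exact: dG.
  split.
  + move=> x; rewrite in_itv/= => /andP[ix _].
    by apply: ex_derive; apply: dG; exact: lt_trans ix.
  + by apply: cvg_at_right_filter; exact: cG.
  + by apply: cvg_at_left_filter; apply: cG; exact: lt_trans iT.
- move=> x; rewrite in_itv/= => /andP[ix _]; rewrite derive1E.
  by apply: derive_val; apply: dG; exact: lt_trans ix.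
Qed.

Lemma mild_powR p : -1 < p -> mild (@powR R ^~ p).
Proof.
move=> p1; split => [t t0|T]; last exact: integrable_powR.
apply: differentiable_continuous; apply/derivable1_diffP.
by apply: ex_derive; exact: is_derive1_powR.
Qed.

Definition cmild (f : R -> R[i]) := mild (re_part f) /\ mild (im_part f).

Lemma Cm1_cmild (f : R -> R[i]) : Cm1 f -> cmild f.
Proof.
move=> [p [u [p1 [cr ci] fE]]].
have mild_part (v w : R -> R) : {within `[0, +oo[, continuous v} ->
    (forall t, 0 < t -> w t = t `^ p * v t) -> mild w.
  move=> cv wE.
  apply: eq_mild (continuousM_mild (freeze0_continuous cv) (mild_powR p1)).
  by move=> t t0; rewrite wE// freezeE ?(ltW t0)// mulrC.
by split; [apply: (mild_part _ _ cr)|apply: (mild_part _ _ ci)] => t t0;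
  rewrite /re_part /im_part fE//; case: (u t) => x y /=; rewrite mul0r ?subr0 ?addr0.
Qed.

End class_Cm1.

(** * Complex-valued functions *)

Section complex_convolution.
Context {R : realType}.
Implicit Types (f g h k : R -> R[i]) (t : R).

Lemma eq_complexP (z w : R[i]) :
  complex.Re z = complex.Re w -> complex.Im z = complex.Im w -> z = w.
Proof. by case: z w => [a b] [c d] /= -> ->. Qed.

Lemma integrable_laplace (u v : R -> R) t : mild u -> mild v ->
  (@lebesgue_measure R).-integrable `]0, t[
    (EFin \o (fun x => u (t - x) * v x)).
Proof. by move=> mu mv; apply/integrable_extM; exact: integrable_ext. Qed.

Lemma re_laplace_conv f g : cmild f -> cmild g ->
  re_part (laplace_conv f g) =
    convol (re_part f) (re_part g) \- convol (im_part f) (im_part g).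
Proof.
move=> [fr fi] [gr gi]; apply/funext => t.
rewrite [LHS]/= {1}/re_part /laplace_conv /cintegral [LHS]/= /= /convol.
rewrite -RintegralB//; try exact: integrable_laplace.
apply: eq_Rintegral => x _; rewrite /re_part /im_part.
by case: (f _) => a b; case: (g _) => c d.
Qed.

Lemma im_laplace_conv f g : cmild f -> cmild g ->
  im_part (laplace_conv f g) =
    convol (re_part f) (im_part g) \+ convol (im_part f) (re_part g).
Proof.
move=> [fr fi] [gr gi]; apply/funext => t.
rewrite [LHS]/= {1}/im_part /laplace_conv /cintegral [LHS]/= /= /convol.
rewrite -RintegralD//; try exact: integrable_laplace.
apply: eq_Rintegral => x _; rewrite /re_part /im_part.
by case: (f _) => a b; case: (g _) => c d.
Qed.

Lemma cmild_laplace_conv f g : cmild f -> cmild g -> cmild (laplace_conv f g).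
Proof.
move=> mf mg; have [[fr fi] [gr gi]] := (mf, mg).
by split; [rewrite re_laplace_conv//; apply: mildB|
           rewrite im_laplace_conv//; apply: mildD]; exact: mild_convol.
Qed.

Lemma laplace_convA f g h : cmild f -> cmild g -> cmild h ->
  laplace_conv f (laplace_conv g h) = laplace_conv (laplace_conv f g) h.
Proof.
move=> mf mg mh.
have mfg := cmild_laplace_conv mf mg; have mgh := cmild_laplace_conv mg mh.
have [[fr fi] [gr gi]] := (mf, mg); have [hr hi] := mh.
have mm := @mild_convol R.
apply/funext => t; apply: eq_complexP.
- transitivity (re_part (laplace_conv f (laplace_conv g h)) t) => //.
  transitivity (re_part (laplace_conv (laplace_conv f g) h) t) => //.
  rewrite !re_laplace_conv// !im_laplace_conv//.
  rewrite convolBr ?convolDr ?convolBl ?convolDl ?convolA//=; auto.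
  by repeat match goal with |- context [convol ?u ?v t] =>
    move: (convol u v t) => ? end; ring.
- transitivity (im_part (laplace_conv f (laplace_conv g h)) t) => //.
  transitivity (im_part (laplace_conv (laplace_conv f g) h) t) => //.
  rewrite !im_laplace_conv// !re_laplace_conv//.
  rewrite convolBr ?convolDr ?convolBl ?convolDl ?convolA//=; auto.
  by repeat match goal with |- context [convol ?u ?v t] =>
    move: (convol u v t) => ? end; ring.
Qed.

Lemma eq_laplace_convl f f' g : (forall t, 0 < t -> f t = f' t) ->
  laplace_conv f g = laplace_conv f' g.
Proof.
move=> ff; apply/funext => t; rewrite /laplace_conv /cintegral.
by congr (_ +i* _); apply: eq_Rintegral => x;
  rewrite inE/= in_itv/= /re_part /im_part => /andP[x0 xt]; rewrite ff// subr_gt0.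
Qed.

Lemma laplace_conv_h_power n f : (0 < n)%N -> cmild f ->
  re_part (laplace_conv (@h_power R n) f) = iter n primitive (re_part f) /\
  im_part (laplace_conv (@h_power R n) f) = iter n primitive (im_part f).
Proof.
case: n => // n _ mf; have [fr fi] := mf.
have rh : re_part (@h_power R n.+1) = fun t => t ^+ n / n`!%:R by [].
have ih : im_part (@h_power R n.+1) = fun=> 0 by [].
have mm : mild (fun t : R => t ^+ n / n`!%:R).
  apply: eq_mild (mild_iter_primitive n (mild_cst 1)) => t t0.
  by rewrite -monomial_iter_primitive.
have m0 : mild (fun=> 0 : R) := mild_cst 0.
have mh : cmild (@h_power R n.+1) by split; rewrite ?rh ?ih.
rewrite re_laplace_conv// im_laplace_conv// rh ih !convol0l !convol_monomial//.
by split; apply/funext => t /=; rewrite ?subr0 ?addr0.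
Qed.

End complex_convolution.

(** * The fundamental theorem *)

Lemma cderivable_n_has_deriven (R : realType) n (f : R -> R[i]) :
  cderivable_n n f -> forall i, (i <= n)%N ->
  has_deriven i (re_part f) (derive1n i (re_part f)) /\
  has_deriven i (im_part f) (derive1n i (im_part f)).
Proof.
move=> df i le_in; split; apply: has_deriven_derive1n => j t ji t0;
  by have [] := df j t (leq_trans ji le_in) t0.
Qed.

Theorem theorem2p3 (R : realType) (n : nat) (kappa k : R -> R[i])
    (n_gt0 : (0 < n)%N)
    (kappa_k : kernel_pair n kappa k)
    (kappa_smooth : Cm1_n n.-1 kappa)
    (f : R -> R[i]) (f_dom : GFD_domain n k f) :
  exists a : 'I_n -> R[i],
    (forall i : 'I_n, right_limit_at0 (cderiven i (GFI k f)) (a i)) /\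
    (forall t : R, 0 < t ->
       GFI kappa (GFD n k f) t =
       f t - \sum_(i < n) a i * cderiven (n.-1 - i) kappa t).
Proof.
case: kappa_k => /Cm1_cmild mkappa k_class kappa_kE.
have mk : cmild k.
  by apply: Cm1_cmild; case: k_class => p [u [p1 _ cu kE]]; exists p, u.
case: kappa_smooth => _ dkappa _.
case: f_dom => /Cm1_cmild mf dg /Cm1_cmild mphi.
set phi := GFD n k f in mphi *.
set g := laplace_conv k f in dg.
have [kr ki] := mkappa; have [phr phi_i] := mphi.
have [a1 lim1 g1E] := taylor_mild (fun i t im t0 => (dg i t im t0).1) phr.
have [a2 lim2 g2E] := taylor_mild (fun i t im t0 => (dg i t im t0).2) phi_i.
exists (fun i => a1 i +i* a2 i); split.
  by move=> i; split; [exact: lim1|exact: lim2].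
have [e1 e2] := laplace_conv_h_power n_gt0 mf.
rewrite -(eq_laplace_convl f kappa_kE) -laplace_convA// in e1 e2.
have dK i : (i < n)%N ->
    has_deriven i (re_part kappa) (derive1n i (re_part kappa)) /\
    has_deriven i (im_part kappa) (derive1n i (im_part kappa)).
  move=> im; apply: (cderivable_n_has_deriven dkappa).
  by case: n n_gt0 im {kappa_kE dkappa dg phi mphi phr phi_i lim1 lim2 g1E g2E e1 e2}.
have mg : cmild g by exact: cmild_laplace_conv.
have D11 := has_deriven_convol kr phr (fun i im => (dK i im).1) g1E.
have D12 := has_deriven_convol kr phi_i (fun i im => (dK i im).1) g2E.
have D21 := has_deriven_convol ki phr (fun i im => (dK i im).2) g1E.
have D22 := has_deriven_convol ki phi_i (fun i im => (dK i im).2) g2E.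
(* [kappa * g], differentiated [n] times above through the Taylor expansion of [g], is
   also the [n]-fold primitive of [f]. *)
have Dre := has_derivenB D11 D22; rewrite -re_laplace_conv// e1 in Dre.
have Dim := has_derivenD D12 D21; rewrite -im_laplace_conv// e2 in Dim.
have [fr fi] := mf.
move=> t t0; apply: eq_complexP.
- rewrite raddfB raddf_sum.
  rewrite -[LHS]/(re_part (laplace_conv kappa phi) t) re_laplace_conv//.
  rewrite -[X in _ = X - _]/(re_part f t).
  rewrite (has_deriven_unique (has_deriven_iter_primitive n fr) Dre t0).
  under [X in _ = _ - X]eq_bigr do rewrite /=.
  rewrite sumrB /=; move: (convol (re_part kappa) (re_part phi) t) (convol (im_part kappa) (im_part phi) t) => u v.
  by move: (\sum_(i < n) _) (\sum_(i < n) _) => S1 S2; ring.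
- rewrite raddfB raddf_sum.
  rewrite -[LHS]/(im_part (laplace_conv kappa phi) t) im_laplace_conv//.
  rewrite -[X in _ = X - _]/(im_part f t).
  rewrite (has_deriven_unique (has_deriven_iter_primitive n fi) Dim t0).
  under [X in _ = _ - X]eq_bigr do rewrite /=.
  rewrite big_split /=; move: (convol (re_part kappa) (im_part phi) t) (convol (im_part kappa) (re_part phi) t) => u v.
  by move: (\sum_(i < n) _) (\sum_(i < n) _) => S1 S2; ring.
Qed.
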